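(* Let $L$ be a loop with holomorph $H(L)$. Then $L$ is an IP-SIPL if and only if $H(L)$ is an IP-SIPL.
   Context: A loop is an inverse property loop (IPL) if every element $x$ has an inverse $x^{-1}$ such that $x^{-1}\cdot(x\cdot y)=y=(y\cdot x)\cdot x^{-1}$ for all $y$. A loop is a Smarandache inverse property loop (SIPL) if it has at least one non-trivial subloop that is an IPL. An IP-SIPL is a loop that is both an IPL and a SIPL. Mappings are written on the right, so $\alpha\beta$ means first $\alpha$, then $\beta$. For a loop $(L,\cdot)$ let $Aum(L,\cdot)$ be its automorphism group. The holomorph $H(L)=(H,\circ)$ is the loop on the set $H$ of pairs $(\alpha,x)$ with $\alpha\in Aum(L,\cdot)$, $x\in L$, with operation $(\alpha,x)\circ(\beta,y)=(\alpha\beta,\ x\beta\cdot y)$. *)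

(* Defs.v *)
From HB Require Import structures.
From mathcomp Require Import all_boot boolp.

Set Implicit Arguments.
Unset Strict Implicit.
Unset Printing Implicit Defensive.

Local Open Scope group_scope.

HB.mixin Record Magma_isQuasigroup G of Magma G := {
  ldivg_uniq : forall a b : G, exists! x : G, a * x = b;
  rdivg_uniq : forall a b : G, exists! y : G, y * a = b
}.

#[short(type="loopType")]
HB.structure Definition Loop := {L of Magma_isQuasigroup L & UMagma L}.

(* A subloop of L is a subset S (classically, a boolean predicate) that is a
   loop for the induced operation. *)
#[short(type="subLoopType")]
HB.structure Definition SubLoop (L : umagmaType) (S : pred L) :=
  {H of SubUMagma L S H & Loop H}.

Definition is_inverse (L : loopType) (x x' : L) : Prop :=
  x * x' = 1 /\ x' * x = 1.

Definition is_IPL (L : loopType) : Prop :=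
  forall x : L, exists x' : L,
    is_inverse x x' /\
    forall y : L, x' * (x * y) = y /\ (y * x) * x' = y.

(* A non-trivial subloop is one different from {1}; it need not be proper. *)
Definition is_SIPL (L : loopType) : Prop :=
  exists (S : pred L) (H : subLoopType S),
    (exists2 x : L, S x & x <> 1) /\ is_IPL H.

Definition is_IP_SIPL (L : loopType) : Prop := is_IPL L /\ is_SIPL L.

Record autom (L : magmaType) := Autom {
  autom_fun :> {multiplicative L -> L};
  autom_bij : bijective autom_fun
}.

HB.instance Definition _ (L : magmaType) := gen_eqMixin (autom L).
HB.instance Definition _ (L : magmaType) := gen_choiceMixin (autom L).

Lemma autom_inj (L : magmaType) (a b : autom L) : a =1 b -> a = b.
Proof.
case: a b => [[f [[fM]]] fb] [[g [[gM]]] gb] /= /funext fg.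
by subst g; rewrite (Prop_irrelevance gM fM) in gb *;
   rewrite (Prop_irrelevance gb fb).
Qed.

Definition autom_id (L : magmaType) : autom L :=
  @Autom L (idfun : {multiplicative L -> L}) (Bijective (frefl _) (frefl _)).

(* Mappings act on the right: autom_comp a b applies a first, then b. *)
Definition autom_comp (L : magmaType) (a b : autom L) : autom L :=
  @Autom L (b \o a : {multiplicative L -> L})
    (bij_comp (autom_bij b) (autom_bij a)).

Lemma autom1 (L : loopType) (a : autom L) : a 1 = 1.
Proof.
have [x [_ xU]] := ldivg_uniq (a 1) (a 1).
have x1 : x = 1 by apply: xU; rewrite mulg1.
have xa1 : x = a 1 by apply: xU; rewrite -gmulfM mulg1.
by rewrite -xa1 x1.
Qed.

Lemma autom_inv (L : magmaType) (a : autom L) :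
  exists b : autom L, cancel a b /\ cancel b a.
Proof.
have [g ag ga] := autom_bij a.
have gM : {morph g : x y / x * y}.
  by move=> x y; rewrite -{1}(ga x) -{1}(ga y) -gmulfM ag.
pose gm := HB.pack_for {multiplicative L -> L} g
             (isMultiplicative.Build L L g gM).
by exists (@Autom L gm (Bijective ga ag)).
Qed.

Definition holomorph (L : loopType) : Type := (autom L * L)%type.

Section Holomorph.
Variable L : loopType.
Local Notation H := (holomorph L).

Definition holomorph_mul (u v : H) : H :=
  (autom_comp u.1 v.1, v.1 u.2 * v.2).

HB.instance Definition _ := Choice.copy H (autom L * L)%type.
HB.instance Definition _ := hasMul.Build H holomorph_mul.

Let one : H := (autom_id L, 1).

Fact holomorph_mul1 : left_id one holomorph_mul.
Proof.
move=> [a x]; rewrite /holomorph_mul /= autom1 mul1g.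
by congr pair; apply: autom_inj.
Qed.

Fact holomorph_mulr1 : right_id one holomorph_mul.
Proof.
move=> [a x]; rewrite /holomorph_mul /= mulg1.
by congr pair; apply: autom_inj.
Qed.

HB.instance Definition _ := Magma_isUMagma.Build H holomorph_mul1 holomorph_mulr1.

Fact holomorph_ldiv (u v : H) : exists! w : H, u * w = v.
Proof.
case: u v => [a x] [c z]; have [b [ab ba]] := autom_inv a.
pose d := autom_comp b c.
have [y [yE yU]] := ldivg_uniq (d x) z.
exists (d, y); split.
  by congr pair; [apply: autom_inj => t /=; rewrite ab | rewrite -yE].
case=> d' y' [/(congr1 (fun f : autom L => f : L -> L)) /= dE yE'].
have <- : d = d' by apply: autom_inj => t /=; rewrite -dE /= ba.
rewrite (yU y') // -yE'; congr (_ * _).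
by rewrite /= -dE /= ba.
Qed.

Fact holomorph_rdiv (u v : H) : exists! w : H, w * u = v.
Proof.
case: u v => [a x] [c z]; have [b [ab ba]] := autom_inv a.
have [y [yE yU]] := rdivg_uniq x z.
exists (autom_comp c b, b y); split.
  by congr pair; [apply: autom_inj => t /= | rewrite -yE]; rewrite /= ba.
case=> d' y' [/(congr1 (fun f : autom L => f : L -> L)) /= dE yE'].
congr pair; first by apply: autom_inj => t /=; rewrite -dE /= ab.
by rewrite (yU _ yE') ab.
Qed.

HB.instance Definition _ :=
  Magma_isQuasigroup.Build H holomorph_ldiv holomorph_rdiv.

End Holomorph.

(* Main.v *)
From HB Require Import structures.
From mathcomp Require Import all_boot boolp.
Require Import Defs.

(** A subloop is allowed to be the whole loop, so a loop that is an IPL has a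
    non-trivial IPL subloop exactly when it has an element other than [1]
    ([is_IP_SIPLE]).  The theorem thus splits into two transfers between [L]
    and its holomorph.

    Non-triviality transfers because [L] embeds by [x |-> (id, x)], and a
    one-element loop has only the identity automorphism.

    The inverse property transfers ([is_IPL_holomorph]) because the inverse of
    [(a, x)] has to be [(a^-1, a^-1 x')], with [x'] the inverse of [x].  When
    this pair multiplies [(a, x) o (b, y)] on the left, the automorphisms [a]
    and [a^-1] cancel and the second component is [b x' * (b x * y)]; as [b] is
    a surjective morphism, this is [b] applied to an instance of
    [x' * (x * z) = z].  On the right one gets the image by [a^-1] of
    [(a y * x) * x'].  Conversely, the law of [L] is that of the pairs
    [(id, x)], and an inverse of [(id, x)] has first component [id]. *)

Set Implicit Arguments.
Unset Strict Implicit.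
Unset Printing Implicit Defensive.

Local Open Scope group_scope.

(** A copy of [L], which carries the structure of the subloop [predT] of [L];
    being convertible to [L], it is an IPL whenever [L] is. *)
Definition full_subloop (L : loopType) : Type := L.

HB.instance Definition _ (L : loopType) := Loop.on (full_subloop L).

Lemma full_subloop_rect (L : loopType) (K : full_subloop L -> Type) :
  (forall (x : L) (_ : predT x), K x) -> forall u : full_subloop L, K u.
Proof. by move=> Kx u; apply: Kx. Qed.

HB.instance Definition _ (L : loopType) :=
  @isSub.phant_Build L predT (full_subloop L) (fun u => u) (fun x _ => x)
    (@full_subloop_rect L) (fun x _ => erefl x).

HB.instance Definition _ (L : loopType) :=
  isSubMagma.Build L predT (full_subloop L) (fun x y => erefl (x * y)).

HB.instance Definition _ (L : loopType) :=
  isSubBaseUMagma.Build L predT (full_subloop L) (erefl (1 : L)).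

Lemma is_IP_SIPLE (L : loopType) :
  is_IP_SIPL L <-> is_IPL L /\ exists x : L, x <> 1.
Proof.
split=> [[IPL [S [H [[x _ x_neq1] _]]]]|[IPL [x x_neq1]]].
  by split=> //; exists x.
by split=> //; exists predT, (full_subloop L : subLoopType predT); split=> //;
   exists x.
Qed.

Lemma holomorph_nontrivial (L : loopType) :
  (exists x : L, x <> 1) <-> (exists u : holomorph L, u <> 1).
Proof.
split=> [[x x_neq1]|[[a x] u_neq1]].
  by exists (autom_id L, x) => -[].
apply: contrapT => /forallNP L1; apply: u_neq1.
have {}L1 (y : L) : y = 1 by apply: contrapT; apply: L1.
by rewrite (L1 x); congr pair; apply: autom_inj => y; rewrite (L1 (a y)) (L1 y).
Qed.

Lemma is_IPL_holomorph (L : loopType) : is_IPL L <-> is_IPL (holomorph L).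
Proof.
split=> [IPL [a x]|IPL x].
  have [x' [[xx' x'x] x'K]] := IPL x.
  have [b [ab ba]] := autom_inv a.
  exists (b, b x'); split=> [|[c y]].
    split; congr pair; first 1 last.
    - by rewrite /= -gmulfM xx' autom1.
    - by apply: autom_inj => t /=; rewrite ba.
    - by rewrite /= ba.
    by apply: autom_inj => t /=; rewrite ab.
  split; congr pair.
  - by apply: autom_inj => t /=; rewrite ba.
  - have [c' [_ c'K]] := autom_inv c.
    (* With y = c (c' y), the term is the image by c of x' * (x * c' y). *)
    by rewrite /= ba -(c'K y) -!gmulfM (x'K _).1.
  - by apply: autom_inj => t /=; rewrite ab.
  by rewrite /= -gmulfM (x'K _).2 ab.
have [[a x'] [[xx' x'x] x'K]] := IPL (autom_id L, x).
have a_id t : a t = t := congr1 (fun u : holomorph L => u.1 t) xx'.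
exists x'; split=> [|y].
  by move: (congr1 snd xx') (congr1 snd x'x); rewrite /= a_id.
have [/(congr1 snd) lK /(congr1 snd)] := x'K (autom_id L, y).
by rewrite /= a_id.
Qed.

Theorem theorem3p5 (L : loopType) : is_IP_SIPL L <-> is_IP_SIPL (holomorph L).
Proof. by rewrite !is_IP_SIPLE is_IPL_holomorph holomorph_nontrivial. Qed.
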